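(* Let $f:\mathbb{R}^n\to\mathbb{R}\cup\{+\infty\}$, $g:\mathbb{R}^m\to\mathbb{R}\cup\{+\infty\}$, $A\in\mathbb{R}^{m\times n}$ and $\phi(x)\equiv f(x)+g(Ax)$ satisfy the standing assumptions (S1) and (S2) given in the context, and let $\alpha>0$, $r>0$. For $\rho>0$ consider the relaxed and accelerated ADMM (R-A-ADMM) algorithm for the problem $\min_x\phi(x)$, with updates $$x_{k+1}=\operatorname{argmin}_{x\in\mathbb{R}^n}\Big\{\rho^{-1}f(x)+\tfrac12\|Ax-(\hat z_k-\hat u_k)\|^2\Big\},$$ $$z_{k+1}=\operatorname{argmin}_{z\in\mathbb{R}^m}\Big\{\rho^{-1}g(z)+\tfrac12\|z-(\alpha Ax_{k+1}+(1-\alpha)\hat z_k+\hat u_k)\|^2\Big\},$$ $$u_{k+1}=\hat u_k+\alpha Ax_{k+1}+(1-\alpha)\hat z_k-z_{k+1},$$ $$\gamma_{k+1}=\frac{k+\sqrt\rho}{k+r+\sqrt\rho},$$ $$\hat u_{k+1}=u_{k+1}+\gamma_{k+1}(u_{k+1}-u_k),\qquad \hat z_{k+1}=z_{k+1}+\gamma_{k+1}(z_{k+1}-z_k),$$ initialized with $x_0\in\operatorname{dom}\phi$, $\hat z_0=z_0=Ax_0$, $\hat u_0=u_0=0$. Let $\epsilon\equiv\rho^{-1/2}$ and $t\equiv\epsilon k$ ($k=0,1,\dots$). Then in the limit $\epsilon\to0$ these updates tend (in the sense given in the context) to the differential inclusion $$\alpha^{-1}A^TA\Big[\ddot X(t)+\frac{r}{t+1}\dot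 X(t)\Big]\in-\partial\phi(X(t)),\qquad X(0)=x_0,\quad \dot X(0)=0 .$$
   Context: For a function $h$ with effective domain $\operatorname{dom}h=\{x: h(x)<\infty\}$, the subdifferential at $x\in\operatorname{dom}h$ is $\partial h(x)=\{v: h(y)-h(x)\ge\langle v,y-x\rangle\ \forall y\in\operatorname{dom}h\}$. Standing assumptions. (S1) $f$ and $g$ are closed (closed epigraph) and convex, and $\phi=f+g\circ A$ has a finite global minimum; $A$ has full column rank, so $A^TA$ is invertible. The paper takes this to include that $f,g$ are proper and lower semicontinuous and $0\in\operatorname{int}(\operatorname{dom}g-A\operatorname{dom}f)$, so that $\partial\phi(x)=\partial f(x)+A^T\partial g(Ax)$. (S2) There are constants $c>0$, $L>0$ such that every $\xi\in\partial\phi(x)$ satisfies $\|\xi\|\le c(1+\|x\|)$, and $\langle\xi_y-\xi_x,y-x\rangle\le L\|y-x\|^2$ for all $x,y$ and all $\xi_x\in\partial\phi(x)$, $\xi_y\in\partial\phi(y)$. A solution of a second-order differential inclusion on $\mathcal I=[0,T]\subset\mathbb{R}_+$ is understood through its first-order form: $X$ and $\dot X$ are absolutely continuous and the inclusion holds for almost all $t\in\mathcal I$. Meaning of the limit. Iterates are identified with points on the grid $t_k=\epsilon k$. It is assumed throughout that there are continuous functions $X,Z,U,\hat Z,\hat U$ of time with $x_k\approx X(t_k)$, $z_k\approx Z(t_k)$, $u_k\approx U(t_k)$, $\hat z_k\approx\hat Z(t_k)$, $\hat u_k\approx\hat U(t_k)$, the approximation becoming exact as $\epsilon\to0$, and that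 the standard finite-difference approximations $\dot X(t_k)=\pm(x_{k\pm1}-x_k)/\epsilon+O(\epsilon)$, $\ddot X(t_k)=(x_{k+1}-2x_k+x_{k-1})/\epsilon^2+O(\epsilon)$ (and similarly for the other variables) may be used. That the updates ''tend to'' a differential inclusion means that, in the limit $\epsilon\to0$, the function $X$ is a solution of that inclusion with the stated initial condition(s). *)

(* Defs.v *)
From HB Require Import structures.
From mathcomp Require Import all_boot all_order all_algebra.
From mathcomp Require Import all_classical all_reals all_analysis.
Import Order.TTheory GRing.Theory Num.Theory.
Import numFieldNormedType.Exports.

Set Implicit Arguments.
Unset Strict Implicit.
Unset Printing Implicit Defensive.

Local Open Scope classical_set_scope.
Local Open Scope ring_scope.

(* The library norm of 'cV[R]_d is the sup norm; the Euclidean structure of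
   R^d is introduced here.  The two norms induce the same topology. *)
Definition dotp (R : realType) (d : nat) (u v : 'cV[R]_d) : R :=
  \sum_(i < d) u i ord0 * v i ord0.

Definition enorm (R : realType) (d : nat) (u : 'cV[R]_d) : R :=
  Num.sqrt (dotp u u).

(* Functions R^d -> R U {+oo} are functions into \bar R that avoid -oo;
   this is part of [proper_efunction]. *)
Definition edom (R : realType) (d : nat) (h : 'cV[R]_d -> \bar R) :
    set 'cV[R]_d := [set x | (h x < +oo)%E].

Definition proper_efunction (R : realType) (d : nat)
    (h : 'cV[R]_d -> \bar R) : Prop :=
  (forall x, (-oo < h x)%E) /\ edom h !=set0.

Definition epigraph (R : realType) (d : nat) (h : 'cV[R]_d -> \bar R) :
    set ('cV[R]_d * R^o)%type :=
  [set p | (h p.1 <= (p.2 : R)%:E)%E].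

(* A closed epigraph is lower semicontinuity. *)
Definition closed_function (R : realType) (d : nat)
    (h : 'cV[R]_d -> \bar R) : Prop := closed (epigraph h).

Definition convex_efunction (R : realType) (d : nat)
    (h : 'cV[R]_d -> \bar R) : Prop :=
  convex_set (epigraph h : set (convex_lmodType ('cV[R]_d * R^o)%type)).

(* Empty outside the effective domain. *)
Definition subdiff (R : realType) (d : nat) (h : 'cV[R]_d -> \bar R)
    (x : 'cV[R]_d) : set 'cV[R]_d :=
  [set v | edom h x /\
     forall y, edom h y -> ((dotp v (y - x))%:E <= h y - h x)%E].

Definition argmin (R : realType) (d : nat) (F : 'cV[R]_d -> \bar R) :
    set 'cV[R]_d := [set x | forall y, (F x <= F y)%E].

Definition composite (R : realType) (n m : nat) (f : 'cV[R]_n -> \bar R)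
    (g : 'cV[R]_m -> \bar R) (A : 'M[R]_(m, n)) (x : 'cV[R]_n) : \bar R :=
  (f x + g (A *m x))%E.

Record assumption_S1 (R : realType) (n m : nat) (f : 'cV[R]_n -> \bar R)
    (g : 'cV[R]_m -> \bar R) (A : 'M[R]_(m, n)) : Prop := AssumptionS1 {
  S1_f_proper : proper_efunction f;
  S1_f_closed : closed_function f;
  S1_f_convex : convex_efunction f;
  S1_g_proper : proper_efunction g;
  S1_g_closed : closed_function g;
  S1_g_convex : convex_efunction g;
  S1_min : exists2 x, composite f g A x \is a fin_num
                      & argmin (composite f g A) x;
  S1_rank : \rank A = n;
  S1_qualification :
    interior [set y - A *m x | y in edom g & x in edom f] 0 }.

Definition assumption_S2 (R : realType) (n : nat)
    (phi : 'cV[R]_n -> \bar R) : Prop :=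
  (exists2 c : R, 0 < c &
     forall x xi, subdiff phi x xi -> enorm xi <= c * (1 + enorm x)) /\
  (exists2 L : R, 0 < L &
     forall x y xix xiy, subdiff phi x xix -> subdiff phi y xiy ->
       dotp (xiy - xix) (y - x) <= L * enorm (y - x) ^+ 2).

(* The coefficient with index k+1, used to form the k+1-st extrapolation. *)
Definition momentum (R : realType) (r rho : R) (k : nat) : R :=
  (k%:R + Num.sqrt rho) / (k%:R + r + Num.sqrt rho).

Record raadmm (R : realType) (n m : nat) (f : 'cV[R]_n -> \bar R)
    (g : 'cV[R]_m -> \bar R) (A : 'M[R]_(m, n)) (alpha r rho : R)
    (x0 : 'cV[R]_n) (x : nat -> 'cV[R]_n) (z u zh uh : nat -> 'cV[R]_m) :
    Prop := RAADMM {
  raadmm_x0 : x 0%N = x0;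
  raadmm_z0 : z 0%N = A *m x0;
  raadmm_zh0 : zh 0%N = z 0%N;
  raadmm_u0 : u 0%N = 0;
  raadmm_uh0 : uh 0%N = u 0%N;
  raadmm_x : forall k, argmin (fun y : 'cV[R]_n =>
    (rho^-1%:E * f y
     + (2^-1 * enorm (A *m y - (zh k - uh k)) ^+ 2)%:E)%E) (x k.+1);
  raadmm_z : forall k, argmin (fun y : 'cV[R]_m =>
    (rho^-1%:E * g y
     + (2^-1 * enorm (y - (alpha *: (A *m x k.+1) + (1 - alpha) *: zh k
                           + uh k)) ^+ 2)%:E)%E) (z k.+1);
  raadmm_u : forall k,
    u k.+1 = uh k + alpha *: (A *m x k.+1) + (1 - alpha) *: zh k - z k.+1;
  raadmm_uh : forall k, uh k.+1 = u k.+1 + momentum r rho k *: (u k.+1 - u k);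
  raadmm_zh : forall k, zh k.+1 = z k.+1 + momentum r rho k *: (z k.+1 - z k) }.

Definition stepsize (R : realType) (rho : R) : R := (Num.sqrt rho)^-1.

Definition grid (R : realType) (rho : R) (k : nat) : R :=
  stepsize rho * k%:R.

(* Derivative relative to [0, T]: two-sided inside, one-sided at 0 and T. *)
Definition derivative_at (R : realType) (d : nat) (T : R)
    (X : R -> 'cV[R]_d) (t : R) (v : 'cV[R]_d) : Prop :=
  (fun s : R => (s - t)^-1 *: (X s - X t)) @ within `[0, T] (t^') --> v.

(* Meaning of [x_k ~ X(t_k)] for a family of sequences indexed by rho, in the
   limit rho -> +oo (that is, stepsize -> 0), on the time interval [0, T]:
   X is continuous and is the uniform limit of the iterates on the grid; its
   derivative V is approximated at rate O(stepsize), uniformly on the grid, by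
   forward and backward difference quotients; its second derivative W is
   approximated at rate O(stepsize) by second difference quotients.

   As V is in general only Lipschitz, W is required to exist almost everywhere
   only, and the last approximation is required only as stepsize -> 0 with t a
   fixed point of the grid, for almost every t.  This is implied by an
   approximation holding at all the grid points with a common constant. *)
Definition continuum_limit (R : realType) (d : nat) (T : R)
    (x : R -> nat -> 'cV[R]_d) (X : R -> 'cV[R]_d) : Prop :=
  [/\ {within `[0, T], continuous X},
      forall e : R, 0 < e -> \forall rho \near +oo%R,
        forall k, grid rho k <= T -> enorm (x rho k - X (grid rho k)) < e
    & exists V W : R -> 'cV[R]_d,
      [/\ forall t : R, t \in `[0, T] -> derivative_at T X t (V t),
          exists C : R, \forall rho \near +oo%R,
            forall k, grid rho k.+1 <= T ->
              let dx := (stepsize rho)^-1 *: (x rho k.+1 - x rho k) in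
              enorm (V (grid rho k) - dx) <= C * stepsize rho /\
              enorm (V (grid rho k.+1) - dx) <= C * stepsize rho
        & {ae (@lebesgue_measure R), forall t : R, t \in `[0, T] ->
             derivative_at T V t (W t) /\
             exists C : R, \forall rho \near +oo%R,
               forall k, grid rho k.+1 = t ->
                 enorm (W t - (stepsize rho)^-1 ^+ 2 *:
                          (x rho k.+2 - 2 *: x rho k.+1 + x rho k))
                   <= C * stepsize rho}]].

Definition absolutely_continuous_on (R : realType) (d : nat) (T : R)
    (X : R -> 'cV[R]_d) : Prop :=
  forall e : R, 0 < e -> exists2 delta : R, 0 < delta &
    forall (N : nat) (a b : 'I_N -> R),
      (forall i, 0 <= a i /\ a i <= b i /\ b i <= T) ->
      (forall i j, i != j -> b i <= a j \/ b j <= a i) ->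
      \sum_(i < N) (b i - a i) < delta ->
      \sum_(i < N) enorm (X (b i) - X (a i)) < e.

(* X solves, on [0, T],
     alpha^-1 A^T A (X'' + r / (t + 1) X') \in - (subdifferential of phi at X),
     X(0) = x0,  X'(0) = 0,
   in the sense of first-order form: X and V = X' are absolutely continuous
   and the inclusion holds almost everywhere, with W = X''. *)
Definition solution (R : realType) (n m : nat) (T : R)
    (phi : 'cV[R]_n -> \bar R) (A : 'M[R]_(m, n)) (alpha r : R)
    (x0 : 'cV[R]_n) (X : R -> 'cV[R]_n) : Prop :=
  exists V W : R -> 'cV[R]_n,
    [/\ absolutely_continuous_on T X /\ absolutely_continuous_on T V,
        forall t : R, t \in `[0, T] -> derivative_at T X t (V t),
        {ae (@lebesgue_measure R), forall t : R, t \in `[0, T] ->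
           derivative_at T V t (W t) /\
           subdiff phi (X t)
             (- (alpha^-1 *: (A^T *m A *m (W t + (r / (t + 1)) *: V t))))},
        X 0 = x0
      & V 0 = 0].

(* Main.v *)
(* Write epsilon = rho^(-1/2).  In the limit the updates of u, zh and uh give
   Zh = Z, Uh = U and Z = A X.  The optimality conditions of the two argmins,
   divided by rho, say in the limit that U is normal to dom g at A X and that
   - A^T U is normal to dom f at X, hence <U, y - A x> <= 0 for all y in dom g
   and x in dom f; as 0 is interior to dom g - A dom f, this forces U = 0.
   Undivided, the two conditions add up to an inequality for
   f (x_(k+2)) + g (z_(k+2)) whose linear part is rho times
   (u_(k+2) - uh_(k+1)) + (z_(k+2) - zh_(k+1)) up to factors; the momentum
   rule turns this into U'' + r/(t+1) U' + Z'' + r/(t+1) Z', and lower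
   semicontinuity gives the inclusion at every t where the second derivatives
   exist. *)
Require Import Defs.
From HB Require Import structures.
From mathcomp Require Import all_boot all_order all_algebra.
From mathcomp Require Import all_classical all_reals all_analysis.
From mathcomp Require Import ring lra.
Import Order.TTheory GRing.Theory Num.Theory.
Import numFieldNormedType.Exports.

Local Open Scope classical_set_scope.
Local Open Scope ring_scope.

(** * Sup norm, Euclidean norm, inner product, and limits taken coordinatewise *)

Lemma ler_coord_norm {R : realType} {d : nat} (u : 'cV[R]_d) (i : 'I_d) :
  `|u i ord0| <= `|u|.
Proof.
rewrite [leRHS]/Num.Def.normr /= mx_normrE.
exact: (le_bigmax _ (fun ij : 'I_d * 'I_1 => `|u ij.1 ij.2|) (i, ord0)).
Qed.

Lemma norm_ler_coord {R : realType} {d : nat} (u : 'cV[R]_d) (e : R) :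
  0 <= e -> (forall i, `|u i ord0| <= e) -> `|u| <= e.
Proof.
move=> e0 ue; rewrite [leLHS]/Num.Def.normr /= mx_normrE.
by apply/bigmax_leP; split=> // -[i j] _ /=; rewrite (ord1 j).
Qed.

Lemma dotp_ge0 {R : realType} {d : nat} (u : 'cV[R]_d) : 0 <= dotp u u.
Proof. by apply: sumr_ge0 => i _; rewrite -expr2 sqr_ge0. Qed.

Lemma sqr_enorm {R : realType} {d : nat} (u : 'cV[R]_d) :
  enorm u ^+ 2 = dotp u u.
Proof. by rewrite sqr_sqrtr ?dotp_ge0. Qed.

Lemma norm_le_enorm {R : realType} {d : nat} (u : 'cV[R]_d) :
  `|u| <= enorm u.
Proof.
apply: norm_ler_coord => [|i]; first exact: sqrtr_ge0.
rewrite -sqrtr_sqr ler_wsqrtr // /dotp (bigD1 i) //= -expr2 lerDl.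
by apply: sumr_ge0 => j _; rewrite -expr2 sqr_ge0.
Qed.

Lemma enorm_le_norm {R : realType} {d : nat} (u : 'cV[R]_d) :
  enorm u <= Num.sqrt d%:R * `|u|.
Proof.
rewrite -[X in _ * X]ger0_norm // -sqrtr_sqr -sqrtrM ?ler0n //.
apply: ler_wsqrtr; have -> : d%:R * `|u| ^+ 2 = \sum_(i < d) `|u| ^+ 2.
  by rewrite sumr_const card_ord mulr_natl.
apply: ler_sum => i _; rewrite -expr2 -real_normK ?num_real //.
by rewrite lerXn2r ?nnegrE ?ler_coord_norm.
Qed.

Lemma dotpE {R : realType} {d : nat} (u v : 'cV[R]_d) :
  dotp u v = (u^T *m v) ord0 ord0.
Proof. by rewrite mxE; apply: eq_bigr => i _; rewrite mxE. Qed.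

Lemma dotpDl {R : realType} {d : nat} (u v w : 'cV[R]_d) :
  dotp (u + v) w = dotp u w + dotp v w.
Proof. by rewrite !dotpE linearD mulmxDl mxE. Qed.

Lemma dotpDr {R : realType} {d : nat} (u v w : 'cV[R]_d) :
  dotp u (v + w) = dotp u v + dotp u w.
Proof. by rewrite !dotpE mulmxDr mxE. Qed.

Lemma dotpZl {R : realType} {d : nat} (a : R) (u v : 'cV[R]_d) :
  dotp (a *: u) v = a * dotp u v.
Proof. by rewrite !dotpE linearZ /= -scalemxAl mxE. Qed.

Lemma dotpZr {R : realType} {d : nat} (a : R) (u v : 'cV[R]_d) :
  dotp u (a *: v) = a * dotp u v.
Proof. by rewrite !dotpE -scalemxAr mxE. Qed.

Lemma dotpC {R : realType} {d : nat} (u v : 'cV[R]_d) : dotp u v = dotp v u.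
Proof. by apply: eq_bigr => i _; rewrite mulrC. Qed.

Lemma dotpNl {R : realType} {d : nat} (u v : 'cV[R]_d) :
  dotp (- u) v = - dotp u v.
Proof. by rewrite -scaleN1r dotpZl mulN1r. Qed.

Lemma dotpNr {R : realType} {d : nat} (u v : 'cV[R]_d) :
  dotp u (- v) = - dotp u v.
Proof. by rewrite -scaleN1r dotpZr mulN1r. Qed.

Lemma dotp_mulmxr {R : realType} {n m : nat} (A : 'M[R]_(m, n))
    (u : 'cV[R]_m) (v : 'cV[R]_n) : dotp u (A *m v) = dotp (A^T *m u) v.
Proof. by rewrite !dotpE trmx_mul trmxK mulmxA. Qed.

Lemma dotp_eq0 {R : realType} {d : nat} (u : 'cV[R]_d) :
  dotp u u <= 0 -> u = 0.
Proof.
move=> u0; apply/eqP; rewrite -normr_le0.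
by rewrite (le_trans (norm_le_enorm u)) // /enorm ler0_sqrtr.
Qed.

Lemma cvg_cV {R : realType} {d : nat} {T : Type} {F : set_system T}
    {FF : Filter F} (u : T -> 'cV[R]_d) (l : 'cV[R]_d) :
  (forall i, (fun t => u t i ord0) @ F --> l i ord0) -> u @ F --> l.
Proof.
move=> ul; apply/cvgrPdist_le => e e0.
have ule (i : 'I_d) : \forall t \near F, `|l i ord0 - u t i ord0| <= e.
  by have /cvgrPdist_le := ul i; apply.
have : \forall t \near F, forall i, `|l i ord0 - u t i ord0| <= e.
  exact: filter_forall.
apply: filterS => t ut; apply: norm_ler_coord => [|i]; first exact: ltW.
by rewrite !mxE.
Qed.

Lemma cvg_coord {R : realType} {d : nat} {T : Type} {F : set_system T}
    {FF : Filter F} (u : T -> 'cV[R]_d) (l : 'cV[R]_d) (i : 'I_d) :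
  u @ F --> l -> (fun t => u t i ord0) @ F --> l i ord0.
Proof. by move=> ul; exact: (cvg_comp u _ ul (@coord_continuous R d 1 i ord0 l)). Qed.

Lemma cvg_mulmx {R : realType} {n m : nat} {T : Type} {F : set_system T}
    {FF : Filter F} (A : 'M[R]_(m, n)) (u : T -> 'cV[R]_n) (l : 'cV[R]_n) :
  u @ F --> l -> (fun t => A *m u t) @ F --> A *m l.
Proof.
move=> ul; apply: cvg_cV => i; rewrite mxE.
rewrite (_ : (fun t => _) = (fun t => \sum_j A i j * u t j ord0)); last first.
  by apply/funext => t; rewrite mxE.
apply: cvg_big => [|j _]; first exact: add_continuous.
by apply: cvgM; [exact: cvg_cst|exact: cvg_coord].
Qed.

Lemma cvg_dotp {R : realType} {d : nat} {T : Type} {F : set_system T}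
    {FF : Filter F} (u v : T -> 'cV[R]_d) (a b : 'cV[R]_d) :
  u @ F --> a -> v @ F --> b -> (fun t => dotp (u t) (v t)) @ F --> dotp a b.
Proof.
move=> ua vb; apply: cvg_big => [|j _]; first exact: add_continuous.
by apply: cvgM; exact: cvg_coord.
Qed.

(** * Closed and convex functions: lower semicontinuity and proximal steps *)

(** The complement of the epigraph is open and contains [(l, a)], so it eventually contains
    [(u t, a)]. *)
Lemma closed_function_lsc {R : realType} {d : nat} {h : 'cV[R]_d -> \bar R}
    {T : Type} {F : set_system T} {FF : Filter F}
    {u : T -> 'cV[R]_d} {l : 'cV[R]_d} {a : R} :
  closed_function h -> u @ F --> l -> (a%:E < h l)%E ->
  \forall t \near F, (a%:E < h (u t))%E.
Proof.
rewrite /closed_function => clh ul ahl.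
have oph : open (~` epigraph h) by rewrite openC.
have lah : (~` epigraph h) (l, a : R^o).
  by rewrite /epigraph /= => /(lt_le_trans ahl); rewrite ltxx.
have nh := open_nbhs_nbhs (conj oph lah).
have ua : (fun t => (u t, a : R^o)) @ F --> (l, a : R^o).
  by apply: (@cvg_pair _ _ _ F (nbhs l) (nbhs (a : R^o))) => //; exact: cvg_cst.
have : \forall t \near F, (~` epigraph h) (u t, a : R^o) by exact: ua nh.
by apply: filterS => t; rewrite /epigraph /= ltNge => /negP.
Qed.

Lemma convex_efunction_segment {R : realType} {d : nat}
    {h : 'cV[R]_d -> \bar R} {x y : 'cV[R]_d} {a b t : R} :
  0 <= t <= 1 -> convex_efunction h -> (h x <= a%:E)%E -> (h y <= b%:E)%E ->
  (h (x + t *: (y - x))%R <= (a + t * (b - a))%:E)%E.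
Proof.
case/andP=> t0 t1 ch hx hy.
have /set_mem := ch (y, b : R^o) (x, a : R^o) (Itv01 t0 t1)
  (mem_set hy) (mem_set hx).
rewrite /epigraph /conv /=.
have -> : t *: y + (1 - t) *: x = x + t *: (y - x).
  by rewrite scalerBr scalerBl scale1r addrCA.
suff -> : t *: (b : R^o) + (1 - t) *: (a : R^o) = a + t * (b - a) by [].
by rewrite /GRing.scale /=; ring.
Qed.

(** Stands in for letting [t] tend to 0 in a first-order variation. *)
Lemma affine_ge0 {R : realFieldType} (p q : R) : 0 <= q ->
  (forall t, 0 < t <= 1 -> 0 <= p + t * q) -> 0 <= p.
Proof.
move=> q0 pq; rewrite leNgt; apply/negP => p0.
have qp : 0 < q - p by lra.
(* If [p < 0], this [t] lies in []0, 1]] and makes the value [- p ^ 2 / (q - p)], which is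
   negative. *)
have := pq (- p / (q - p)); rewrite divr_gt0 ?oppr_gt0 // ler_pdivrMr //.
have -> : p + - p / (q - p) * q = - (p ^+ 2 / (q - p)) by field; lra.
rewrite oppr_ge0 => /(_ _)/wrap[]; first lra.
by rewrite leNgt divr_gt0 // exprn_even_gt0 //= lt_eqF.
Qed.

(** Compare [x] with [x + t (y - x)]. By convexity the objective grows by at most [t (p + t q)],
    where [p] is the claimed nonnegative quantity and [q] is half the squared norm of [B (y - x)];
    divide by [t] and apply [affine_ge0]. Properness makes [h x] finite, so that [fine] loses
    nothing. *)
Lemma argmin_prox {R : realType} {d p : nat} {h : 'cV[R]_d -> \bar R}
    {B : 'M[R]_(p, d)} {b : 'cV[R]_p} {c : R} {x : 'cV[R]_d} :
  0 < c -> proper_efunction h -> convex_efunction h ->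
  argmin (fun y => c%:E * h y + (2^-1 * enorm (B *m y - b) ^+ 2)%:E)%E x ->
  edom h x /\ forall y, edom h y ->
    0 <= c * (fine (h y) - fine (h x)) + dotp (B *m x - b) (B *m (y - x)).
Proof.
move=> c0 [hNoo [y0 hy0]] ch xmin.
have hfin y : edom h y -> (fine (h y))%:E = h y.
  by move=> hy; rewrite fineK // fin_real // hNoo.
have hx : edom h x.
  rewrite /edom /= ltNge leye_eq; apply/eqP => hx.
  by have /= := xmin y0; rewrite hx -(hfin _ hy0) gt0_muley ?lte_fin //.
split=> // y hy.
move: (hfin _ hx) (hfin _ hy); move: (fine (h x)) (fine (h y)) => hx' hy' hxE hyE.
apply: (affine_ge0 _ (2^-1 * dotp (B *m (y - x)) (B *m (y - x)))).
  by rewrite mulr_ge0 ?invr_ge0 // dotp_ge0.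
move=> t /andP[t0 t1].
have hxy : (h (x + t *: (y - x))%R <= (hx' + t * (hy' - hx'))%:E)%E.
  by apply: convex_efunction_segment; rewrite ?(ltW t0) ?hxE ?hyE.
have cE : (0 <= c%:E)%E by rewrite lee_fin ltW.
have := le_trans (xmin (x + t *: (y - x))) (leeD2r _ (lee_wpmul2l cE hxy)).
rewrite -hxE -!EFinM -!EFinD lee_fin !sqr_enorm.
rewrite mulmxDr -scalemxAr addrAC.
move: (B *m x - b) (B *m (y - x)) => u v.
rewrite !(dotpDl, dotpDr, dotpZl, dotpZr) (dotpC v u) => H.
rewrite -(pmulr_rge0 _ t0); nra.
Qed.

Lemma ereal_real_below {R : realType} (x : \bar R) :
  (-oo < x)%E -> exists a : R, (a%:E < x)%E.
Proof.
case: x => [x| |] // _; last by exists 0; rewrite ltry.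
by exists (x - 1); rewrite lte_fin ltrBlDr ltrDl.
Qed.

(** Turns lower semicontinuity of two functions into a bound on the sum of their values at the
    limit, without knowing beforehand that these values are finite. *)
Lemma lee_addP {R : realType} {x y : \bar R} {M : R} :
  (-oo < x)%E -> (-oo < y)%E ->
  (forall a b : R, (a%:E < x)%E -> (b%:E < y)%E -> a + b <= M) ->
  (x + y <= M%:E)%E.
Proof.
have real (z : \bar R) (c : R) : (-oo < z)%E ->
    (forall a : R, (a%:E < z)%E -> a <= c) -> (z <= c%:E)%E.
  case: z => [z| |] // _ zc.
    rewrite lee_fin; apply/ler_addgt0Pr => e e0.
    by rewrite -lerBlDr zc // lte_fin; lra.
  by have := zc (c + 1) (ltry (c + 1)); rewrite gerDl ler10.
move=> x0 y0 xyM; have [a ax] := ereal_real_below _ x0.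
have [b bx] := ereal_real_below _ y0.
(* One real [b] below [y] already bounds [x] above, so [x] is real and can be moved to the other
   side. *)
have : (x <= (M - b)%:E)%E.
  by apply: (real _) => // c cx; rewrite lerBrDr xyM.
case: x x0 ax xyM => [x| |] // _ ax xyM _.
rewrite addeC -leeBrDr // -EFinB; apply: (real _) => // c cy.
rewrite lerBrDr -lerBrDl -lee_fin; apply: (real _ _ (ltNyr _)) => e ex.
by rewrite lerBrDr xyM.
Qed.

(** * Grids passing through a given time *)

(* The parameters [rho] for which [s] is the grid point of index [N + 1]. *)
Definition grid_rho {R : realType} (s : R) (N : nat) : R := (N.+1%:R / s) ^+ 2.

Lemma grid_rho_gt0 {R : realType} (s : R) (N : nat) :
  0 < s -> 0 < grid_rho s N.
Proof. by move=> s0; rewrite exprn_gt0 // divr_gt0. Qed.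

Lemma stepsize_grid_rho {R : realType} (s : R) (N : nat) :
  0 < s -> stepsize (grid_rho s N) = s / N.+1%:R.
Proof.
by move=> s0; rewrite /stepsize sqrtr_sqr ger0_norm ?invf_div // divr_ge0 // ltW.
Qed.

Lemma grid_grid_rho {R : realType} (s : R) (N : nat) :
  0 < s -> grid (grid_rho s N) N.+1 = s.
Proof. by move=> s0; rewrite /grid stepsize_grid_rho // mulfVK. Qed.

Lemma stepsize_grid_rho_cvg {R : realType} (s : R) :
  0 < s -> (fun N => stepsize (grid_rho s N)) @ \oo --> (0 : R).
Proof.
move=> s0; rewrite (_ : (fun N => _) = (fun N => s * harmonic N)); last first.
  by apply/funext => N; rewrite stepsize_grid_rho.
by rewrite -[X in _ --> X](mulr0 s); apply: cvgM; [exact: cvg_cst|exact: cvg_harmonic].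
Qed.

Lemma grid_rho_cvg {R : realType} (s : R) :
  0 < s -> grid_rho s @ \oo --> +oo%R.
Proof.
move=> s0; apply/cvgryPge => M.
have /cvgryPge /(_ (s ^+ 2 * M)) := @cvgr_idn R.
apply: filterS => N sMN; rewrite /grid_rho expr_div_n ler_pdivlMr ?exprn_gt0 //.
rewrite mulrC (le_trans sMN) // (@le_trans _ _ N.+1%:R) ?ler_nat //.
by rewrite expr2 ler_peMl ?ler1n.
Qed.

Lemma gridD {R : realType} (rho : R) (i j : nat) :
  grid rho (i + j) = grid rho i + stepsize rho * j%:R.
Proof. by rewrite /grid natrD mulrDr. Qed.

Lemma stepsize_gt0 {R : realType} (rho : R) : 0 < rho -> 0 < stepsize rho.
Proof. by move=> rho0; rewrite invr_gt0 sqrtr_gt0. Qed.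

Lemma grid_ge0 {R : realType} (rho : R) (k : nat) : 0 <= grid rho k.
Proof. by rewrite mulr_ge0 // invr_ge0 sqrtr_ge0. Qed.

(** * Regularity of the limit curve: [X] and its derivative are Lipschitz *)

(** Uniform closeness on the grid and continuity of [X] within [[0, T]] allow the grid point to move
    with [N]. *)
Lemma continuum_limit_cvg {R : realType} {d : nat} {T : R}
    {x : R -> nat -> 'cV[R]_d} {X : R -> 'cV[R]_d} {rho : nat -> R}
    {k : nat -> nat} {s : R} :
  continuum_limit T x X -> s \in `[0, T] -> rho @ \oo --> +oo%R ->
  (fun N => grid (rho N) (k N)) @ \oo --> s ->
  (\forall N \near \oo, grid (rho N) (k N) <= T) ->
  (fun N => x (rho N) (k N)) @ \oo --> X s.
Proof.
case=> Xc xX _ sT hrho gs gT.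
have /subspace_continuousP/(_ s) XcT := Xc.
have Xgs : (fun N => X (grid (rho N) (k N))) @ \oo --> X s.
  apply: cvg_comp (XcT _) => //.
  move=> P /= /gs; apply: filterS2 gT => N gT; apply => /=.
  by rewrite in_itv /= grid_ge0.
apply/cvgrPdist_le => e e0; have e2 : 0 < e / 2 by rewrite divr_gt0.
have /cvgrPdist_le/(_ _ e2) := Xgs.
have := hrho _ (xX _ e2).
apply: filterS3 gT => N gT /(_ _ gT) /ltW /(le_trans (norm_le_enorm _)) H1 H2.
rewrite (splitr e) (le_trans (ler_distD (X (grid (rho N) (k N))) _ _)) //.
by rewrite lerD // distrC.
Qed.

(** The first-order clause of [continuum_limit] for a single [rho] and a fixed constant. *)
Definition derivative_bound {R : realType} {d : nat} (T rho C : R)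
    (x : nat -> 'cV[R]_d) (V : R -> 'cV[R]_d) : Prop :=
  forall k, grid rho k.+1 <= T ->
    let dx := (stepsize rho)^-1 *: (x k.+1 - x k) in
    enorm (V (grid rho k) - dx) <= C * stepsize rho /\
    enorm (V (grid rho k.+1) - dx) <= C * stepsize rho.

(** At two neighbouring grid points [V] is within [C * stepsize rho] of the same quotient, so it
    moves by at most twice that per step; summing over the steps gives the first bound, and summing
    once more the quadratic one. *)
Lemma difference_quotient_lipschitz {R : realType} {d : nat} {T rho C : R}
    {x : nat -> 'cV[R]_d} {V : R -> 'cV[R]_d} :
  0 < rho -> 0 <= C -> derivative_bound T rho C x V ->
  forall i j, grid rho (i + j) <= T ->
    `|V (grid rho (i + j)) - V (grid rho i)| <= 2 * C * (stepsize rho * j%:R) /\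
    `|x (i + j)%N - x i - (stepsize rho * j%:R) *: V (grid rho i)|
      <= 2 * C * (stepsize rho * j%:R) ^+ 2.
Proof.
move=> rho0 C0 xV i; have e0 := stepsize_gt0 _ rho0.
elim=> [|j IH].
  by rewrite addn0 mulr0 subrr normr0 scale0r !subrr normr0 expr0n mulr0.
rewrite addnS => ijT; have /xV[] := ijT => /(le_trans (norm_le_enorm _)) H1.
move=> /(le_trans (norm_le_enorm _)) H2.
have /IH[H3 H4] : grid rho (i + j) <= T.
  by apply: le_trans ijT; rewrite /grid ler_wpM2l ?ler_nat // ltW.
move: e0 H1 H2 H3 H4; set e := stepsize rho; set V0 := V (grid rho i).
set V1 := V (grid _ _); set V2 := V (grid _ _); set dx := _ *: _.
move=> e0 H1 H2 H3 H4; split.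
  have -> : V2 - V0 = (V2 - dx) - (V1 - dx) + (V1 - V0) by rewrite opprB !subrKA.
  rewrite (le_trans (ler_normD _ _)) // (le_trans (lerD (ler_normB _ _) H3)) //.
  by rewrite (le_trans (lerD (lerD H2 H1) (lexx _))) //; nra.
(* The new step is [e *: dx], and [dx = V0 + (V1 - V0) - (V1 - dx)]. *)
have -> : x (i + j).+1 - x i - (e * j.+1%:R) *: V0 =
    (x (i + j)%N - x i - (e * j%:R) *: V0) - e *: (V1 - dx) + e *: (V1 - V0).
  by apply/colP => l; rewrite /dx !mxE; field; rewrite gt_eqF.
rewrite (le_trans (ler_normD _ _)) // (le_trans (lerD (ler_normB _ _) (lexx _))) //.
rewrite !normrZ (gtr0_norm e0).
rewrite (le_trans (lerD (lerD H4 (ler_wpM2l (ltW e0) H1)) (ler_wpM2l (ltW e0) H3))) //.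
rewrite -subr_ge0; have -> : 2 * C * (e * j.+1%:R) ^+ 2 -
   (2 * C * (e * j%:R) ^+ 2 + e * (C * e) + e * (2 * C * (e * j%:R))) =
   C * e ^+ 2 * (2 * j%:R + 1) by ring.
by rewrite !mulr_ge0 // ?exprn_ge0 ?addr_ge0 ?mulr_ge0 // ltW.
Qed.

Lemma near_grid_exists {R : realType} {s : R} : 0 <= s ->
  exists (rho : nat -> R) (i : nat -> nat),
    [/\ forall N, 0 < rho N, rho @ \oo --> +oo%R,
        (fun N => stepsize (rho N)) @ \oo --> (0 : R)
      & forall N, grid (rho N) (i N) = s].
Proof.
rewrite le_eqVlt => /predU1P[<-|s0].
  (* The origin is the point of index 0 of every grid, so any parameters tending to infinity
     serve. *)
  exists (grid_rho 1), (fun=> 0%N); split=> [N|||N]; last by rewrite /grid mulr0.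
  - exact: grid_rho_gt0.
  - exact: grid_rho_cvg.
  - exact: stepsize_grid_rho_cvg.
exists (grid_rho s), S; split=> [N|||N].
- exact: grid_rho_gt0.
- exact: grid_rho_cvg.
- exact: stepsize_grid_rho_cvg.
- exact: grid_grid_rho.
Qed.

(** The largest number of whole steps fitting into [l] misses [l] by less than one step. *)
Lemma steps_below_cvg {R : realType} {e : nat -> R} {l : R} :
  0 <= l -> (forall N, 0 < e N) -> e @ \oo --> (0 : R) ->
  (forall N, e N * (Num.truncn (l / e N))%:R <= l) /\
  (fun N => e N * (Num.truncn (l / e N))%:R) @ \oo --> l.
Proof.
move=> l0 e0 ecvg.
have H N : e N * (Num.truncn (l / e N))%:R <= l < e N * (Num.truncn (l / e N))%:R + e N.
  have /truncn_itv/andP[] : 0 <= l / e N by rewrite divr_ge0 // ltW.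
  by rewrite ler_pdivlMr // ltr_pdivrMr // -natr1 mulrDl mul1r mulrC => -> ->.
split=> [N|]; first by case/andP: (H N).
have el : (fun N => l - e N) @ \oo --> l.
  by have := cvgB (cvg_cst l) ecvg; rewrite subr0; apply.
apply: (squeeze_cvgr _ el (cvg_cst l)).
by apply: nearW => N; case/andP: (H N) => ? ?; lra.
Qed.

(* Each of the two estimates uses grids passing through the point at which [V]
   is evaluated: [s] and [t] need not lie on a common grid. *)
Lemma continuum_limit_taylor {R : realType} {d : nat} {T : R}
    {x : R -> nat -> 'cV[R]_d} {X V : R -> 'cV[R]_d} {C : R} :
  continuum_limit T x X -> 0 <= C ->
  (\forall rho \near +oo%R, derivative_bound T rho C (x rho) V) ->
  forall s t, 0 <= s -> s <= t -> t <= T ->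
    `|X t - X s - (t - s) *: V s| <= 2 * C * (t - s) ^+ 2 /\
    `|X t - X s - (t - s) *: V t| <= 4 * C * (t - s) ^+ 2.
Proof.
move=> hX C0 hV s t s0 st tT.
have t0 := le_trans s0 st; have sT := le_trans st tT.
have ts0 : 0 <= t - s by rewrite subr_ge0.
have bnd (c v : R) (w : nat -> R) : w @ \oo --> v ->
  (fun N => c * C * (w N) ^+ 2) @ \oo --> c * C * v ^+ 2.
  by move=> wv; apply: cvgM; [exact: cvg_cst|exact: cvgM].
split.
  have [rho [i [rho0 hrho he gi]]] := near_grid_exists s0.
  have [jle jcvg] := steps_below_cvg ts0 (fun N => stepsize_gt0 _ (rho0 N)) he.
  set j := fun N => Num.truncn ((t - s) / stepsize (rho N)).
  have ijT N : grid (rho N) (i N + j N) <= T.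
    by rewrite gridD gi; have := jle N; rewrite -/(j N); lra.
  have xi : (fun N => x (rho N) (i N)) @ \oo --> X s.
    apply: (continuum_limit_cvg hX) => //; first by rewrite in_itv /= s0.
      by under eq_fun do rewrite gi; exact: cvg_cst.
    by apply: nearW => N; rewrite gi.
  have xij : (fun N => x (rho N) (i N + j N)%N) @ \oo --> X t.
    apply: (continuum_limit_cvg hX) => //; first by rewrite in_itv /= t0.
      under eq_fun do rewrite gridD gi.
      by have := cvgD (cvg_cst s) jcvg; rewrite subrKC; apply.
    exact: nearW.
  have L : (fun N => `|x (rho N) (i N + j N)%N - x (rho N) (i N)
      - (stepsize (rho N) * (j N)%:R) *: V s|) @ \oo -->
      `|X t - X s - (t - s) *: V s|.
    by apply: cvg_norm; apply: cvgB; [exact: cvgB|apply: cvgZl].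
  apply: (ler_cvg_to L (bnd _ _ _ jcvg)).
  have hVN : \forall N \near \oo, derivative_bound T (rho N) C (x (rho N)) V.
    exact: hrho hV.
  apply: filterS hVN => N hN.
  by have [_] := difference_quotient_lipschitz (rho0 N) C0 hN _ _ (ijT N); rewrite gi.
(* Now the grids pass through [t], and [j N] steps are counted backwards from it. The left end only
   approaches [s], where no continuity of [V] is available yet, so [V] there is traded for [V t]. *)
have [rho [k [rho0 hrho he gk]]] := near_grid_exists t0.
have [jle jcvg] := steps_below_cvg ts0 (fun N => stepsize_gt0 _ (rho0 N)) he.
set j := fun N => Num.truncn ((t - s) / stepsize (rho N)).
have jk N : (j N <= k N)%N.
  rewrite -(@ler_nat R) -(ler_pM2l (stepsize_gt0 _ (rho0 N))).
  by have := jle N; have := gk N; rewrite /grid -/(j N); lra.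
pose i N := (k N - j N)%N.
have ijk N : (i N + j N)%N = k N by rewrite subnK.
have gi N : grid (rho N) (i N) = t - stepsize (rho N) * (j N)%:R.
  by rewrite -(gk N) -(ijk N) gridD addrK.
have xi : (fun N => x (rho N) (i N)) @ \oo --> X s.
  apply: (continuum_limit_cvg hX) => //; first by rewrite in_itv /= s0.
    under eq_fun do rewrite gi.
    by have := cvgB (cvg_cst t) jcvg; rewrite subKr; apply.
  apply: nearW => N; rewrite gi.
  have : 0 <= stepsize (rho N) * (j N)%:R by rewrite mulr_ge0 // ltW ?stepsize_gt0.
  lra.
have xk : (fun N => x (rho N) (k N)) @ \oo --> X t.
  apply: (continuum_limit_cvg hX) => //; first by rewrite in_itv /= t0.
    by under eq_fun do rewrite gk; exact: cvg_cst.
  by apply: nearW => N; rewrite gk.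
have L : (fun N => `|x (rho N) (k N) - x (rho N) (i N)
    - (stepsize (rho N) * (j N)%:R) *: V t|) @ \oo -->
    `|X t - X s - (t - s) *: V t|.
  by apply: cvg_norm; apply: cvgB; [exact: cvgB|apply: cvgZl].
apply: (ler_cvg_to L (bnd _ _ _ jcvg)).
have hVN : \forall N \near \oo, derivative_bound T (rho N) C (x (rho N)) V.
  exact: hrho hV.
apply: filterS hVN => N hN.
have ijT : grid (rho N) (i N + j N) <= T by rewrite ijk gk.
have [] := difference_quotient_lipschitz (rho0 N) C0 hN _ _ ijT.
rewrite ijk gk -/(j N); set e := stepsize _ * _ => Vlip xtay.
have e0 : 0 <= e by rewrite mulr_ge0 // ltW ?stepsize_gt0.
(* The trade costs [e] times the variation of [V] over the steps, which is another [2 * C * e ^ 2];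
   hence the constant 4. *)
have -> : x (rho N) (k N) - x (rho N) (i N) - e *: V t =
  (x (rho N) (k N) - x (rho N) (i N) - e *: V (grid (rho N) (i N)))
  - e *: (V t - V (grid (rho N) (i N))) by apply/colP => l; rewrite !mxE; ring.
rewrite (le_trans (ler_normB _ _)) // normrZ (ger0_norm e0).
by rewrite (le_trans (lerD xtay (ler_wpM2l e0 Vlip))) //; nra.
Qed.

(** Subtracting the two expansions, taken at the two ends of [[s, t]], bounds [(t - s) (V t - V s)]
    by [6 C (t - s) ^ 2]. Then [V] is bounded on [[0, T]], and the first expansion makes [X]
    Lipschitz. *)
Lemma continuum_limit_lipschitz {R : realType} {d : nat} {T : R}
    {x : R -> nat -> 'cV[R]_d} {X V : R -> 'cV[R]_d} {C : R} :
  continuum_limit T x X -> 0 <= C ->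
  (\forall rho \near +oo%R, derivative_bound T rho C (x rho) V) ->
  exists K, forall s t, 0 <= s -> s <= t -> t <= T ->
    `|X t - X s| <= K * (t - s) /\ `|V t - V s| <= K * (t - s).
Proof.
move=> hX C0 hV.
have tay := continuum_limit_taylor hX C0 hV.
have Vlip s t : 0 <= s -> s <= t -> t <= T -> `|V t - V s| <= 6 * C * (t - s).
  move=> s0; rewrite le_eqVlt => /predU1P[->|st tT]; first by rewrite !subrr normr0 mulr0.
  have ts : 0 < t - s by rewrite subr_gt0.
  have [H1 H2] := tay _ _ s0 (ltW st) tT.
  rewrite -(ler_pM2l ts) -{1}(gtr0_norm ts) -normrZ.
  have -> : (t - s) *: (V t - V s) = (X t - X s - (t - s) *: V s)
      - (X t - X s - (t - s) *: V t) by apply/colP => l; rewrite !mxE; ring.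
  by rewrite (le_trans (ler_normB _ _)) // (le_trans (lerD H1 H2)) //; nra.
(* One constant for both: [6 C] serves [V]; for [X], the sum of [2 C T] from the expansion, and of
   [6 C T] and the norm of [V 0] from the bound on [V]. *)
exists (`|V 0| + 6 * C + 8 * C * T) => s t s0 st tT.
have ts0 : 0 <= t - s by rewrite subr_ge0.
have T0 : 0 <= T by lra.
split; last first.
  rewrite (le_trans (Vlip _ _ s0 st tT)) // ler_wpM2r //.
  by rewrite addrAC lerDr addr_ge0 // mulr_ge0 // mulr_ge0.
have -> : X t - X s = (X t - X s - (t - s) *: V s) + (t - s) *: ((V s - V 0) + V 0).
  by rewrite subrK subrK.
have [H1 _] := tay _ _ s0 st tT.
have H2 := Vlip 0 s (lexx 0) s0 (le_trans st tT).
rewrite (le_trans (ler_normD _ _)) // normrZ (ger0_norm ts0).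
rewrite (le_trans (lerD H1 (ler_wpM2l ts0 (ler_normD _ _)))) //.
rewrite (le_trans (lerD (lexx _) (ler_wpM2l ts0 (lerD H2 (lexx _))))) //.
rewrite subr0.
have -> : 2 * C * (t - s) ^+ 2 + (t - s) * (6 * C * s + `|V 0|) =
  (2 * C * (t - s) + (`|V 0| + 6 * C * s)) * (t - s) by ring.
by rewrite ler_wpM2r //; nra.
Qed.

Lemma lipschitz_absolutely_continuous {R : realType} {d : nat} {T K : R}
    {X : R -> 'cV[R]_d} :
  (forall s t, 0 <= s -> s <= t -> t <= T -> `|X t - X s| <= K * (t - s)) ->
  absolutely_continuous_on T X.
Proof.
(* The factor [Num.sqrt d%:R] compares the two norms; the added 1 makes [M] positive. *)
move=> XK e e0; pose M := Num.sqrt d%:R * `|K| + 1.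
have M0 : 0 < M by rewrite ltr_wpDl // mulr_ge0 // sqrtr_ge0.
exists (e / M); first by rewrite divr_gt0.
move=> N a b ab _ sab.
apply: (@le_lt_trans _ _ (\sum_(i < N) M * (b i - a i))); last first.
  by rewrite -mulr_sumr mulrC -ltr_pdivlMr.
apply: ler_sum => i _; have [a0 [aleb bT]] := ab i.
have ba : 0 <= b i - a i by rewrite subr_ge0.
rewrite (le_trans (enorm_le_norm _)) //.
rewrite (le_trans (ler_wpM2l (sqrtr_ge0 _) (XK _ _ a0 aleb bT))) //.
rewrite mulrA ler_wpM2r // /M (@le_trans _ _ (Num.sqrt d%:R * `|K|)) ?lerDl //.
by rewrite ler_wpM2l ?sqrtr_ge0 ?ler_norm.
Qed.

(** * Limits of iterates, difference quotients and momentum at an interior time *)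

Lemma cvg_enorm {R : realType} {d : nat} {u : nat -> 'cV[R]_d} {l : 'cV[R]_d}
    {C : R} {e : nat -> R} :
  e @ \oo --> (0 : R) -> (\forall N \near \oo, enorm (l - u N) <= C * e N) ->
  u @ \oo --> l.
Proof.
move=> e0 ul.
have Ce0 : (fun N => C * e N) @ \oo --> (0 : R).
  by have := cvgM (cvg_cst C) e0; rewrite mulr0; apply.
apply/cvgrPdist_le => eps eps0.
apply: filterS2 ul (cvgr_le _ Ce0 _ eps0) => N ul Ce.
exact: le_trans (norm_le_enorm _) (le_trans ul Ce).
Qed.

(** In these grids [t] has index [N + 1], so index [j + N] is the time [t + (j - 1) * stepsize]:
    [j = 1] is [t] itself, 0 and 2 are its neighbours. As [t < T], these times eventually stay below
    [T]. *)
Lemma iterate_cvg {R : realType} {d : nat} {T : R}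
    {x : R -> nat -> 'cV[R]_d} {X : R -> 'cV[R]_d} {t : R} (j : nat) :
  continuum_limit T x X -> 0 < t < T ->
  (fun N => x (grid_rho t N) (j + N)%N) @ \oo --> X t.
Proof.
move=> hX /andP[t0 tT].
have gt : (fun N => grid (grid_rho t N) (j + N)) @ \oo --> t.
  rewrite (_ : (fun N => _) =
    (fun N => t + (j%:R - 1) * stepsize (grid_rho t N))); last first.
    apply/funext => N; rewrite -[X in X + _](grid_grid_rho _ N t0) /grid natrD.
    by ring.
  have := cvgD (cvg_cst t) (cvgM (cvg_cst (j%:R - 1 : R)) (stepsize_grid_rho_cvg _ t0)).
  by rewrite mulr0 addr0; apply.
apply: (continuum_limit_cvg hX) => //; first by rewrite in_itv /= !ltW.
  exact: grid_rho_cvg.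
exact: (cvgr_le _ gt _ tT).
Qed.

Lemma difference_quotient_cvg {R : realType} {d : nat} {T C t : R}
    {x : R -> nat -> 'cV[R]_d} {V : R -> 'cV[R]_d} :
  (\forall rho \near +oo%R, derivative_bound T rho C (x rho) V) ->
  0 < t < T ->
  (fun N => (stepsize (grid_rho t N))^-1 *:
     (x (grid_rho t N) N.+1 - x (grid_rho t N) N)) @ \oo --> V t.
Proof.
move=> hV /andP[t0 tT].
apply: (cvg_enorm (stepsize_grid_rho_cvg _ t0)).
have hVN : \forall N \near \oo,
    derivative_bound T (grid_rho t N) C (x (grid_rho t N)) V.
  exact: (grid_rho_cvg _ t0) hV.
apply: filterS hVN => N /(_ N).
by rewrite grid_grid_rho // => /(_ (ltW tT))[_ H]; exact: H.
Qed.

Definition second_derivative_bound {R : realType} {d : nat} (t rho C : R)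
    (x : nat -> 'cV[R]_d) (w : 'cV[R]_d) : Prop :=
  forall k, grid rho k.+1 = t ->
    enorm (w - (stepsize rho)^-1 ^+ 2 *: (x k.+2 - 2 *: x k.+1 + x k))
      <= C * stepsize rho.

Lemma second_difference_cvg {R : realType} {d : nat} {T C t : R}
    {x : R -> nat -> 'cV[R]_d} {w : 'cV[R]_d} :
  (\forall rho \near +oo%R, second_derivative_bound t rho C (x rho) w) ->
  0 < t ->
  (fun N => (stepsize (grid_rho t N))^-1 ^+ 2 *:
     (x (grid_rho t N) N.+2 - 2 *: x (grid_rho t N) N.+1
      + x (grid_rho t N) N)) @ \oo --> w.
Proof.
move=> hW t0; apply: (cvg_enorm (stepsize_grid_rho_cvg _ t0)).
have hWN : \forall N \near \oo,
    second_derivative_bound t (grid_rho t N) C (x (grid_rho t N)) w.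
  exact: (grid_rho_cvg _ t0) hW.
by apply: filterS hWN => N; apply; exact: grid_grid_rho.
Qed.

(** With [e] the stepsize and [k = N], the expression is [r / (e k + 1 + r e)], and [e k = t - e] on
    these grids. *)
Lemma damping_cvg {R : realType} {r t : R} : 0 < r -> 0 < t ->
  (fun N => (stepsize (grid_rho t N))^-1 * (1 - momentum r (grid_rho t N) N))
    @ \oo --> r / (t + 1).
Proof.
move=> r0 t0.
rewrite (_ : (fun N => _) =
    (fun N => r * (t + 1 + (r - 1) * stepsize (grid_rho t N))^-1)); last first.
  apply/funext => N; rewrite /momentum -[Num.sqrt _]invrK -/(stepsize _).
  rewrite stepsize_grid_rho // -natr1.
  have N0 : (0 : R) <= N%:R by [].
  field.
  have tN := mulr_ge0 (ltW t0) N0; have rt := mulr_gt0 r0 t0.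
  apply/and3P; split; rewrite gt_eqF //.
  rewrite (_ : _ + _ = t * N%:R + N%:R + 1 + r * t); last by ring.
  by rewrite addr_gt0 // ltr_wpDl // addr_ge0.
apply: cvgM; first exact: cvg_cst.
apply: cvgV; first by rewrite gt_eqF // addr_gt0.
have := cvgD (cvg_cst (t + 1 : R)) (cvgM (cvg_cst (r - 1 : R)) (stepsize_grid_rho_cvg _ t0)).
by rewrite mulr0 addr0; apply.
Qed.

Lemma momentum_cvg {R : realType} {r t : R} : 0 < r -> 0 < t ->
  (fun N => momentum r (grid_rho t N) N) @ \oo --> (1 : R).
Proof.
move=> r0 t0.
rewrite (_ : (fun N => _) = (fun N => 1 - stepsize (grid_rho t N) *
   ((stepsize (grid_rho t N))^-1 * (1 - momentum r (grid_rho t N) N)))).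
  rewrite -[X in _ --> X]subr0 -(mul0r (r / (t + 1))).
  apply: cvgB; first exact: cvg_cst.
  by apply: cvgM; [exact: stepsize_grid_rho_cvg|exact: damping_cvg].
apply/funext => N.
by rewrite mulVKf ?subKr // gt_eqF // stepsize_gt0 // grid_rho_gt0.
Qed.

(** The gap between [y_(k+2)] and [yh_(k+1)] is the second difference of [y] plus [1 - momentum]
    times its first difference. Divided by the squared stepsize, these produce the acceleration and
    the damping. *)
Lemma inertial_cvg {R : realType} {d : nat} {T C C' r t : R}
    {y yh : R -> nat -> 'cV[R]_d} {V : R -> 'cV[R]_d} {w : 'cV[R]_d} :
  (forall rho, 0 < rho -> forall k, yh rho k.+1 =
     y rho k.+1 + momentum r rho k *: (y rho k.+1 - y rho k)) ->
  (\forall rho \near +oo%R, derivative_bound T rho C (y rho) V) ->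
  (\forall rho \near +oo%R, second_derivative_bound t rho C' (y rho) w) ->
  0 < r -> 0 < t < T ->
  (fun N => (stepsize (grid_rho t N))^-1 ^+ 2 *:
     (y (grid_rho t N) N.+2 - yh (grid_rho t N) N.+1)) @ \oo -->
    w + (r / (t + 1)) *: V t.
Proof.
move=> hyh hV hW r0 tT; have /andP[t0 _] := tT.
rewrite (_ : (fun N => _) = (fun N => (stepsize (grid_rho t N))^-1 ^+ 2 *:
     (y (grid_rho t N) N.+2 - 2 *: y (grid_rho t N) N.+1 + y (grid_rho t N) N)
   + ((stepsize (grid_rho t N))^-1 * (1 - momentum r (grid_rho t N) N)) *:
     ((stepsize (grid_rho t N))^-1 *:
        (y (grid_rho t N) N.+1 - y (grid_rho t N) N)))).
  apply: cvgD; first exact: second_difference_cvg hW t0.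
  by apply: cvgZ; [exact: damping_cvg|exact: difference_quotient_cvg hV tT].
apply/funext => N; rewrite hyh ?grid_rho_gt0 //; apply/colP => i; rewrite !mxE.
by rewrite /GRing.scale /=; ring.
Qed.

(** The increment of [y] vanishes in the limit and the momentum stays bounded, so extrapolation does
    not change the limit. *)
Lemma extrapolation_limit {R : realType} {d : nat} {T r t : R}
    {y yh : R -> nat -> 'cV[R]_d} {Y Yh : R -> 'cV[R]_d} :
  (forall rho, 0 < rho -> forall k, yh rho k.+1 =
     y rho k.+1 + momentum r rho k *: (y rho k.+1 - y rho k)) ->
  continuum_limit T y Y -> continuum_limit T yh Yh ->
  0 < r -> 0 < t < T -> Yh t = Y t.
Proof.
move=> hyh hY hYh r0 tT; have /andP[t0 _] := tT.
suff : (fun N => yh (grid_rho t N) (1 + N)%N) @ \oo --> Y t.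
  by apply: cvg_unique (iterate_cvg 1 hYh tT); exact: norm_hausdorff.
have y0 := iterate_cvg 0 hY tT; have y1 := iterate_cvg 1 hY tT.
rewrite (_ : (fun N => _) = (fun N => y (grid_rho t N) (1 + N)%N +
   momentum r (grid_rho t N) N *:
     (y (grid_rho t N) (1 + N)%N - y (grid_rho t N) (0 + N)%N))).
  rewrite -[X in _ --> X]addr0 -(scaler0 _ 1) -(subrr (Y t)).
  by apply: cvgD => //; apply: cvgZ; [exact: momentum_cvg|exact: cvgB].
by apply/funext => N; rewrite add1n hyh ?grid_rho_gt0.
Qed.

Lemma derivative_at_interior {R : realType} {d : nat} {T t : R}
    {X : R -> 'cV[R]_d} {v : 'cV[R]_d} :
  0 < t < T -> derivative_at T X t v ->
  (fun s => (s - t)^-1 *: (X s - X t)) @ t^' --> v.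
Proof.
move=> /andP[t0 tT]; apply: cvg_trans => P /=.
have nT : \forall s \near t^', `[0, T]%classic s.
  apply: nbhs_dnbhs; apply: filterS2 (lt_nbhsr t0) (lt_nbhsl tT) => s s0 sT.
  by rewrite /= in_itv /= !ltW.
by move=> HP; apply: filterS2 nT HP => s sT; apply.
Qed.

(** Difference quotients commute with [A], and limits are unique. The matrix is arbitrary so that
    the same lemma differentiates [U = 0] as [0 *m X]. *)
Lemma derivative_at_mulmx {R : realType} {n m : nat} {T t : R}
    {A : 'M[R]_(m, n)} {X : R -> 'cV[R]_n} {Z : R -> 'cV[R]_m}
    {v : 'cV[R]_n} {w : 'cV[R]_m} :
  (forall s, 0 < s < T -> Z s = A *m X s) -> 0 < t < T ->
  derivative_at T X t v -> derivative_at T Z t w -> w = A *m v.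
Proof.
move=> ZX tT /(derivative_at_interior tT) Xv /(derivative_at_interior tT) Zw.
suff : (fun s => (s - t)^-1 *: (Z s - Z t)) @ t^' --> A *m v.
  by apply: cvg_unique Zw; exact: norm_hausdorff.
have AX : (fun s => A *m ((s - t)^-1 *: (X s - X t))) @ t^' --> A *m v.
  exact: cvg_mulmx.
apply: cvg_trans AX; apply: near_eq_cvg.
have /andP[t0 tT'] := tT.
apply: nbhs_dnbhs; apply: filterS2 (lt_nbhsr t0) (lt_nbhsl tT') => s s0 sT.
by rewrite !ZX ?s0 // -scalemxAr mulmxBr.
Qed.

(** * Optimality conditions of the two argmins and their limits [Z = A X] and [U = 0] *)

Lemma stepsize_sqr {R : realType} (rho : R) :
  0 < rho -> stepsize rho ^+ 2 = rho^-1.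
Proof. by move=> rho0; rewrite exprVn sqr_sqrtr // ltW. Qed.

Lemma inv_grid_rho_cvg {R : realType} (t : R) :
  0 < t -> (fun N => (grid_rho t N)^-1) @ \oo --> (0 : R).
Proof.
move=> t0; rewrite (_ : (fun N => _) =
  (fun N => stepsize (grid_rho t N) * stepsize (grid_rho t N))); last first.
  by apply/funext => N; rewrite -expr2 stepsize_sqr // grid_rho_gt0.
by rewrite -[X in _ --> X](mulr0 0); apply: cvgM; exact: stepsize_grid_rho_cvg.
Qed.

Lemma lt_fine_edom {R : realType} {d : nat} {h : 'cV[R]_d -> \bar R}
    {x : 'cV[R]_d} {a : R} : edom h x -> (a%:E < h x)%E -> a < fine (h x).
Proof. by rewrite /edom /=; case: (h x) => // r _; rewrite lte_fin. Qed.

Lemma raadmm_x_optimal {R : realType} {n m : nat} {f : 'cV[R]_n -> \bar R}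
    {g : 'cV[R]_m -> \bar R} {A : 'M[R]_(m, n)} {alpha r rho : R}
    {x0 : 'cV[R]_n} {x : nat -> 'cV[R]_n} {z u zh uh : nat -> 'cV[R]_m} :
  raadmm f g A alpha r rho x0 x z u zh uh -> 0 < rho ->
  proper_efunction f -> convex_efunction f -> forall k,
  edom f (x k.+1) /\ forall y, edom f y ->
    0 <= rho^-1 * (fine (f y) - fine (f (x k.+1))) +
         dotp (A *m x k.+1 - (zh k - uh k)) (A *m (y - x k.+1)).
Proof.
move=> H rho0 fp fc k; have rhoV : 0 < rho^-1 by rewrite invr_gt0.
exact: (argmin_prox rhoV fp fc (raadmm_x H k)).
Qed.

Lemma raadmm_z_optimal {R : realType} {n m : nat} {f : 'cV[R]_n -> \bar R}
    {g : 'cV[R]_m -> \bar R} {A : 'M[R]_(m, n)} {alpha r rho : R}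
    {x0 : 'cV[R]_n} {x : nat -> 'cV[R]_n} {z u zh uh : nat -> 'cV[R]_m} :
  raadmm f g A alpha r rho x0 x z u zh uh -> 0 < rho ->
  proper_efunction g -> convex_efunction g -> forall k,
  edom g (z k.+1) /\ forall y, edom g y ->
    dotp (u k.+1) (y - z k.+1) <= rho^-1 * (fine (g y) - fine (g (z k.+1))).
Proof.
move=> H rho0 gp gc k; have rhoV : 0 < rho^-1 by rewrite invr_gt0.
have zmin := raadmm_z H k.
(* The identity matrix brings the update to the form of [argmin_prox]; its residual is [- u k.+1] by
   the dual update. *)
have zmin' : argmin (fun y : 'cV[R]_m => rho^-1%:E * g y + (2^-1 *
    enorm (1%:M *m y - (alpha *: (A *m x k.+1) + (1 - alpha) *: zh k + uh k))
    ^+ 2)%:E)%E (z k.+1).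
  by move=> y; rewrite !mul1mx; exact: zmin.
have [gz gopt] := argmin_prox rhoV gp gc zmin'; split=> // y /gopt.
rewrite !mul1mx (_ : z k.+1 - _ = - u k.+1) ?dotpNl ?subr_ge0 //.
by rewrite (raadmm_u H); apply/colP => i; rewrite !mxE; ring.
Qed.

(** In the limit the dual update reads [U = U + alpha A X + (1 - alpha) Z - Z], that is,
    [alpha (A X - Z) = 0]. *)
Lemma raadmm_consensus {R : realType} {n m : nat} {f : 'cV[R]_n -> \bar R}
    {g : 'cV[R]_m -> \bar R} {A : 'M[R]_(m, n)} {alpha r T : R}
    {x0 : 'cV[R]_n} {x : R -> nat -> 'cV[R]_n} {z u zh uh : R -> nat -> 'cV[R]_m}
    {X : R -> 'cV[R]_n} {Z U Zh Uh : R -> 'cV[R]_m} :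
  0 < alpha -> 0 < r ->
  (forall rho : R, 0 < rho ->
    raadmm f g A alpha r rho x0 (x rho) (z rho) (u rho) (zh rho) (uh rho)) ->
  continuum_limit T x X -> continuum_limit T z Z -> continuum_limit T u U ->
  continuum_limit T zh Zh -> continuum_limit T uh Uh ->
  forall t, 0 < t < T -> [/\ Zh t = Z t, Uh t = U t & Z t = A *m X t].
Proof.
move=> alpha0 r0 H hX hZ hU hZh hUh t tT; have /andP[t0 _] := tT.
have ZhZ : Zh t = Z t.
  by apply: (extrapolation_limit _ hZ hZh r0 tT) => rho /H /raadmm_zh.
have UhU : Uh t = U t.
  by apply: (extrapolation_limit _ hU hUh r0 tT) => rho /H /raadmm_uh.
split=> //.
have xX := iterate_cvg 1 hX tT; have zZ := iterate_cvg 1 hZ tT.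
have zhZ := iterate_cvg 0 hZh tT; have uhU := iterate_cvg 0 hUh tT.
rewrite ZhZ in zhZ; rewrite UhU in uhU.
have uU : (fun N => u (grid_rho t N) (1 + N)%N) @ \oo -->
    U t + alpha *: (A *m X t) + (1 - alpha) *: Z t - Z t.
  rewrite (_ : (fun N => _) = (fun N => uh (grid_rho t N) (0 + N)%N +
      alpha *: (A *m x (grid_rho t N) (1 + N)%N) +
      (1 - alpha) *: zh (grid_rho t N) (0 + N)%N - z (grid_rho t N) (1 + N)%N)).
    apply: cvgB => //; apply: cvgD; last by apply: cvgZ => //; exact: cvg_cst.
    apply: cvgD => //; apply: cvgZ; first exact: cvg_cst.
    exact: cvg_mulmx.
  by apply/funext => N; rewrite (raadmm_u (H _ (grid_rho_gt0 _ N t0))).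
have UE : U t = U t + alpha *: (A *m X t) + (1 - alpha) *: Z t - Z t.
  by apply: cvg_unique (iterate_cvg 1 hU tT) uU; exact: norm_hausdorff.
apply: (scalerI (lt0r_neq0 alpha0)); apply/eqP; rewrite -subr_eq0; apply/eqP.
move/colP: UE => UE; apply/colP => i; move: (UE i); rewrite !mxE; lra.
Qed.

Lemma qualification_dual_zero {R : realType} {n m : nat} {A : 'M[R]_(m, n)}
    {D : set 'cV[R]_m} {E : set 'cV[R]_n} {u : 'cV[R]_m} :
  interior [set y - A *m x | y in D & x in E] 0 ->
  (forall y x, D y -> E x -> dotp u (y - A *m x) <= 0) -> u = 0.
Proof.
move=> /nbhs_ballP[e /= e0 eS] ule.
(* Small enough for [c *: u] to lie in the ball of radius [e]; testing the inequality there gives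
   [c] times the squared norm of [u] at most 0. The added 1 covers [u = 0]. *)
pose c := e / 2 / (`|u| + 1).
have u1 : 0 < `|u| + 1 by rewrite ltr_wpDl.
have c0 : 0 < c by rewrite !divr_gt0.
have [y Dy [x Ex yx]] : [set y - A *m x | y in D & x in E] (c *: u).
  apply: eS; rewrite -ball_normE /= sub0r normrN normrZ gtr0_norm //.
  rewrite /c mulrAC ltr_pdivrMr //; nra.
apply: dotp_eq0; rewrite -(pmulr_rle0 _ c0) -dotpZr -yx.
exact: ule.
Qed.

Lemma raadmm_dual_zero {R : realType} {n m : nat} {f : 'cV[R]_n -> \bar R}
    {g : 'cV[R]_m -> \bar R} {A : 'M[R]_(m, n)} {alpha r T : R}
    {x0 : 'cV[R]_n} {x : R -> nat -> 'cV[R]_n} {z u zh uh : R -> nat -> 'cV[R]_m}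
    {X : R -> 'cV[R]_n} {Z U Zh Uh : R -> 'cV[R]_m} :
  assumption_S1 f g A -> 0 < alpha -> 0 < r ->
  (forall rho : R, 0 < rho ->
    raadmm f g A alpha r rho x0 (x rho) (z rho) (u rho) (zh rho) (uh rho)) ->
  continuum_limit T x X -> continuum_limit T z Z -> continuum_limit T u U ->
  continuum_limit T zh Zh -> continuum_limit T uh Uh ->
  forall t, 0 < t < T -> U t = 0.
Proof.
move=> S1 alpha0 r0 H hX hZ hU hZh hUh t tT; have /andP[t0 _] := tT.
have [ZhZ UhU ZX] := raadmm_consensus alpha0 r0 H hX hZ hU hZh hUh _ tT.
have xX := iterate_cvg 1 hX tT; have zZ := iterate_cvg 1 hZ tT.
have uU := iterate_cvg 1 hU tT.
have zhZ := iterate_cvg 0 hZh tT; have uhU := iterate_cvg 0 hUh tT.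
rewrite ZhZ in zhZ; rewrite UhU in uhU.
have rho0 N := grid_rho_gt0 _ N t0.
(* Lower semicontinuity replaces the values of [f] and [g] at the iterates by fixed real lower
   bounds, so the terms carrying [rho^-1] disappear in the limit. *)
have bnd (p q : R) : (fun N => (grid_rho t N)^-1 * (p - q)) @ \oo --> (0 : R).
  rewrite -[X in _ --> X](mul0r (p - q)).
  by apply: cvgM; [exact: inv_grid_rho_cvg|exact: cvg_cst].
have gU y : edom g y -> dotp (U t) (y - Z t) <= 0.
  move=> gy; have [a aZ] := ereal_real_below _ ((S1_g_proper S1).1 (Z t)).
  have L : (fun N => dotp (u (grid_rho t N) (1 + N)%N)
      (y - z (grid_rho t N) (1 + N)%N)) @ \oo --> dotp (U t) (y - Z t).
    by apply: cvg_dotp => //; apply: cvgB => //; exact: cvg_cst.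
  apply: (ler_cvg_to L (bnd (fine (g y)) a)).
  apply: filterS (closed_function_lsc (S1_g_closed S1) zZ aZ) => N aN.
  have [gz gopt] := raadmm_z_optimal (H _ (rho0 N)) (rho0 N)
    (S1_g_proper S1) (S1_g_convex S1) N.
  rewrite (le_trans (gopt y gy)) // ler_wpM2l ?invr_ge0 ?(ltW (rho0 N)) //.
  by rewrite lerB // ltW // lt_fine_edom.
have fU y : edom f y -> 0 <= dotp (U t) (A *m (y - X t)).
  move=> fy; have [a aX] := ereal_real_below _ ((S1_f_proper S1).1 (X t)).
  have L : (fun N => dotp (A *m x (grid_rho t N) (1 + N)%N -
      (zh (grid_rho t N) (0 + N)%N - uh (grid_rho t N) (0 + N)%N))
      (A *m (y - x (grid_rho t N) (1 + N)%N))) @ \oo -->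
      dotp (U t) (A *m (y - X t)).
    apply: cvg_dotp; last by apply: cvg_mulmx; apply: cvgB => //; exact: cvg_cst.
    (* The residual tends to [A X - (Z - U)], which is [U] because [Z = A X]. *)
    rewrite -[X in _ --> X](subKr (Z t)) {1}ZX.
    by apply: cvgB; [exact: cvg_mulmx|exact: cvgB].
  apply: (ler_cvg_to (bnd a (fine (f y))) L).
  apply: filterS (closed_function_lsc (S1_f_closed S1) xX aX) => N aN.
  have [fx fopt] := raadmm_x_optimal (H _ (rho0 N)) (rho0 N)
    (S1_f_proper S1) (S1_f_convex S1) N.
  have := fopt y fy.
  have : (grid_rho t N)^-1 * a <= (grid_rho t N)^-1 * fine (f (x (grid_rho t N) N.+1)).
    by rewrite ler_wpM2l ?invr_ge0 ?(ltW (rho0 N)) // ltW // lt_fine_edom.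
  rewrite !mulrBr; lra.
apply: (qualification_dual_zero (S1_qualification S1)) => y w /gU Uy /fU Uw.
have -> : y - A *m w = (y - Z t) - A *m (w - X t).
  by rewrite mulmxBr ZX; apply/colP => i; rewrite !mxE; ring.
rewrite dotpDr dotpNr; lra.
Qed.

(** * Effective domain of the composite, injectivity of [A], and the initial conditions *)

Lemma edom_composite {R : realType} {n m : nat} {f : 'cV[R]_n -> \bar R}
    {g : 'cV[R]_m -> \bar R} {A : 'M[R]_(m, n)} {x : 'cV[R]_n} :
  proper_efunction f -> proper_efunction g -> edom (composite f g A) x ->
  [/\ edom f x, edom g (A *m x)
    & composite f g A x = (fine (f x) + fine (g (A *m x)))%:E].
Proof.
move=> [/(_ x) fx _] [/(_ (A *m x)) gx _]; rewrite /edom /composite /=.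
by case: (f x) fx => [a| |] // _; case: (g (A *m x)) gx => [b| |] //= _; rewrite !ltry.
Qed.

Lemma mulmx_eq0_full_rank {R : realType} {n m : nat} {A : 'M[R]_(m, n)}
    {v : 'cV[R]_n} : \rank A = n -> A *m v = 0 -> v = 0.
Proof.
move=> rA Av; apply: trmx_inj; rewrite trmx0.
have rAT : row_free A^T by rewrite /row_free mxrank_tr rA.
by apply/eqP; rewrite -(mulmx_free_eq0 _ rAT) -trmx_mul Av trmx0.
Qed.

Lemma derivative_bound_norm {R : realType} {d : nat} {T rho C : R}
    {x : nat -> 'cV[R]_d} {V : R -> 'cV[R]_d} :
  derivative_bound T rho C x V -> derivative_bound T rho `|C| x V.
Proof.
have e0 : 0 <= stepsize rho by rewrite invr_ge0 sqrtr_ge0.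
have CC : C * stepsize rho <= `|C| * stepsize rho by rewrite ler_wpM2r ?ler_norm.
by move=> H k /H[H1 H2]; split; [exact: le_trans H1 CC|exact: le_trans H2 CC].
Qed.

(* Comparing the first x-update with its value at [x0] bounds
   [|A ((x_1 - x_0) / epsilon)|^2] by [2 (f x_0 - f x_1)], whose limit superior
   is nonpositive because f is lower semicontinuous. *)
Lemma raadmm_initial_velocity {R : realType} {n m : nat}
    {f : 'cV[R]_n -> \bar R} {g : 'cV[R]_m -> \bar R} {A : 'M[R]_(m, n)}
    {alpha r T C : R} {x0 : 'cV[R]_n} {x : R -> nat -> 'cV[R]_n}
    {z u zh uh : R -> nat -> 'cV[R]_m} {X V : R -> 'cV[R]_n} :
  assumption_S1 f g A -> edom f x0 -> 0 < T ->
  (forall rho : R, 0 < rho ->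
    raadmm f g A alpha r rho x0 (x rho) (z rho) (u rho) (zh rho) (uh rho)) ->
  continuum_limit T x X ->
  (\forall rho \near +oo%R, derivative_bound T rho C (x rho) V) ->
  X 0 = x0 /\ V 0 = 0.
Proof.
move=> S1 fx0 T0 H hX hV.
(* Only the indices 0 and 1 matter here, so [grid_rho 1] is just a convenient sequence of parameters
   tending to infinity. *)
have rho0 N : 0 < grid_rho 1 N :> R by exact: grid_rho_gt0.
have e0 := stepsize_grid_rho_cvg (1 : R) ltr01.
have near1 : \forall N \near \oo, grid (grid_rho 1 N) 1 <= T.
  by apply: filterS (cvgr_le _ e0 _ T0) => N; rewrite /grid mulr1.
have in0 : (0 : R) \in `[0, T] by rewrite in_itv /= lexx ltW.
have XE : X 0 = x0.
  have xX : (fun N => x (grid_rho 1 N) 0%N) @ \oo --> X 0.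
    apply: (continuum_limit_cvg hX) => //; first exact: grid_rho_cvg.
      by rewrite /grid; under eq_fun do rewrite mulr0; exact: cvg_cst.
    by apply: nearW => N; rewrite /grid mulr0 ltW.
  have xx0 : (fun N => x (grid_rho 1 N) 0%N) @ \oo --> x0.
    by under eq_fun do rewrite (raadmm_x0 (H _ (rho0 _))); exact: cvg_cst.
  by apply: cvg_unique xX xx0; exact: norm_hausdorff.
split=> //.
have x1X : (fun N => x (grid_rho 1 N) 1%N) @ \oo --> x0.
  rewrite -XE; apply: (continuum_limit_cvg hX) => //; first exact: grid_rho_cvg.
  by rewrite /grid; under eq_fun do rewrite mulr1; exact: e0.
pose q N := (stepsize (grid_rho 1 N))^-1 *: (x (grid_rho 1 N) 1%N - x0).
have qV : q @ \oo --> V 0.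
  apply: (cvg_enorm e0).
  have hVN : \forall N \near \oo,
      derivative_bound T (grid_rho 1 N) C (x (grid_rho 1 N)) V.
    exact: (grid_rho_cvg 1 ltr01) hV.
  apply: filterS2 near1 hVN => N gT /(_ 0%N gT)[+ _].
  by rewrite {1}/grid mulr0 (raadmm_x0 (H _ (rho0 N))) => h; exact: h.
have qf N : edom f (x (grid_rho 1 N) 1%N) /\ dotp (A *m q N) (A *m q N) <=
    2 * (fine (f x0) - fine (f (x (grid_rho 1 N) 1%N))).
  have HN := H _ (rho0 N).
  have [fx1 _] := raadmm_x_optimal HN (rho0 N) (S1_f_proper S1) (S1_f_convex S1) 0.
  (* The penalty vanishes at [x0], since the first target [zh 0 - uh 0] is [A x0]. *)
  split=> //; have := raadmm_x HN 0%N x0.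
  rewrite (raadmm_zh0 HN) (raadmm_uh0 HN) (raadmm_z0 HN) (raadmm_u0 HN).
  rewrite subr0 subrr !sqr_enorm.
  have -> : dotp (0 : 'cV[R]_m) 0 = 0 by rewrite dotpE mulmx0 mxE.
  have ffin y : edom f y -> f y = (fine (f y))%:E.
    by move=> fy; rewrite fineK // fin_real // (S1_f_proper S1).1.
  rewrite {1}(ffin _ fx0) {1}(ffin _ fx1) -!EFinM -!EFinD lee_fin mulr0 addr0.
  rewrite /q -scalemxAr -mulmxBr dotpZl dotpZr mulrA -expr2 exprVn.
  rewrite stepsize_sqr // invrK.
  move: (dotp _ _) (fine _) (fine _) => D a b h.
  have := ler_wpM2l (ltW (rho0 N)) h; rewrite mulrDr !mulrA divff ?gt_eqF // !mul1r.
  lra.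
have AV : A *m V 0 = 0.
  apply: dotp_eq0; apply/ler_addgt0Pr => e epos; rewrite add0r.
  have L : (fun N => dotp (A *m q N) (A *m q N)) @ \oo -->
      dotp (A *m V 0) (A *m V 0) by apply: cvg_dotp; exact: cvg_mulmx.
  apply: (ler_cvg_to L (cvg_cst e)).
  (* Once [f x_1] exceeds [f x0 - e / 2], the bound [2 (f x0 - f x_1)] is below [e]. *)
  have ax0 : ((fine (f x0) - e / 2)%:E < f x0)%E.
    rewrite -{2}(@fineK _ (f x0)) ?fin_real ?(S1_f_proper S1).1 // lte_fin.
    by rewrite ltrBlDr ltrDl divr_gt0.
  apply: filterS (closed_function_lsc (S1_f_closed S1) x1X ax0) => N aN.
  have [fx1 qN] := qf N; have := lt_fine_edom fx1 aN; lra.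
exact: mulmx_eq0_full_rank (S1_rank S1) AV.
Qed.

(** * The differential inclusion at an interior time *)

Lemma raadmm_inclusion {R : realType} {n m : nat} {f : 'cV[R]_n -> \bar R}
    {g : 'cV[R]_m -> \bar R} {A : 'M[R]_(m, n)} {alpha r T t : R}
    {x0 : 'cV[R]_n} {x : R -> nat -> 'cV[R]_n} {z u zh uh : R -> nat -> 'cV[R]_m}
    {X : R -> 'cV[R]_n} {Z U : R -> 'cV[R]_m} {w : 'cV[R]_n} :
  assumption_S1 f g A -> edom (composite f g A) x0 -> 0 < alpha ->
  (forall rho : R, 0 < rho ->
    raadmm f g A alpha r rho x0 (x rho) (z rho) (u rho) (zh rho) (uh rho)) ->
  continuum_limit T x X -> continuum_limit T z Z -> continuum_limit T u U ->
  0 < t < T -> Z t = A *m X t -> U t = 0 ->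
  (fun N => (stepsize (grid_rho t N))^-1 ^+ 2 *:
     (z (grid_rho t N) N.+2 - zh (grid_rho t N) N.+1)) @ \oo --> A *m w ->
  (fun N => (stepsize (grid_rho t N))^-1 ^+ 2 *:
     (u (grid_rho t N) N.+2 - uh (grid_rho t N) N.+1)) @ \oo -->
    (0 : 'cV[R]_m) ->
  subdiff (composite f g A) (X t) (- (alpha^-1 *: (A^T *m A *m w))).
Proof.
move=> S1 phix0 alpha0 H hX hZ hU tT ZX U0; have /andP[t0 _] := tT.
pose rho N := grid_rho t N.
have rho0 N : 0 < rho N := grid_rho_gt0 _ N t0.
have qE N : (stepsize (grid_rho t N))^-1 ^+ 2 = rho N.
  by rewrite exprVn stepsize_sqr ?invrK.
set dz := fun N => _; move=> dzw; set du := fun N => _; move=> du0.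
have xX := iterate_cvg 2 hX tT; have zZ := iterate_cvg 2 hZ tT.
have uU := iterate_cvg 2 hU tT; rewrite U0 in uU.
have [fp gp] := (S1_f_proper S1, S1_g_proper S1).
(* By the dual update, the increments of [u] and [z] from their extrapolations add up to
   [alpha (A x_(N+2) - zh_(N+1))]; this is where the factor [alpha^-1] arises. *)
pose s N := alpha^-1 *: (du N + dz N).
have sE N : s N = rho N *: (A *m x (rho N) N.+2 - zh (rho N) N.+1).
  rewrite /s /du /dz !qE -/(rho N) (raadmm_u (H _ (rho0 N))).
  apply/colP => i; rewrite !mxE; field; rewrite gt_eqF //.
have sw : s @ \oo --> alpha^-1 *: (A *m w).
  apply: cvgZ; first exact: cvg_cst.
  by rewrite -[X in _ --> X]add0r; exact: cvgD.
(* Stated in the extended reals because [X t] is not yet known to lie in the domain. *)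
have key y : edom (composite f g A) y -> (composite f g A (X t) <=
    (fine (f y) + fine (g (A *m y)) +
     dotp (alpha^-1 *: (A^T *m A *m w)) (y - X t))%:E)%E.
  move=> /(edom_composite fp gp)[fy gy _].
  apply: lee_addP; [exact: fp.1|exact: gp.1|move=> a b aX bX].
  rewrite -ZX in bX.
  have L : (fun N => fine (f y) + fine (g (A *m y)) +
      (dotp (s N - du N) (A *m (y - x (rho N) (2 + N)%N)) -
       dotp (u (rho N) (2 + N)%N) (s N - dz N))) @ \oo -->
      fine (f y) + fine (g (A *m y)) +
      dotp (alpha^-1 *: (A^T *m A *m w)) (y - X t).
    have -> : dotp (alpha^-1 *: (A^T *m A *m w)) (y - X t) =
        dotp (alpha^-1 *: (A *m w) - 0) (A *m (y - X t)) -
        dotp 0 (alpha^-1 *: (A *m w) - A *m w).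
      by rewrite subr0 !dotpZl dotp_mulmxr mulmxA [dotp 0 _]dotpE trmx0 mul0mx mxE subr0.
    apply: cvgD; first exact: cvg_cst.
    apply: cvgB; apply: cvg_dotp; [exact: cvgB| |by []|exact: cvgB].
    by apply: cvg_mulmx; apply: cvgB; first exact: cvg_cst.
  apply: (ler_cvg_to (cvg_cst (a + b)) L).
  apply: filterS2 (closed_function_lsc (S1_f_closed S1) xX aX)
    (closed_function_lsc (S1_g_closed S1) zZ bX) => N aN bN.
  have HN := H _ (rho0 N).
  have [fx fopt] := raadmm_x_optimal HN (rho0 N) fp (S1_f_convex S1) N.+1.
  have [gz gopt] := raadmm_z_optimal HN (rho0 N) gp (S1_g_convex S1) N.+1.
  have aN' := lt_fine_edom fx aN; have bN' := lt_fine_edom gz bN.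
  have := fopt y fy; rewrite -lerBlDr sub0r ler_pdivlMl // mulrN -dotpZl.
  have := gopt _ gy; rewrite ler_pdivlMl // -dotpZl.
  (* The term [rho u_(N+2)] has no known limit. It occurs in both optimality conditions and cancels
     in their sum, up to the pairing of [u_(N+2)] with [s N - dz N = rho (A x_(N+2) - z_(N+2))].
     That pairing tends to 0, since [u] does and the other factor converges. *)
  have -> : rho N *: (A *m x (rho N) N.+2 - (zh (rho N) N.+1 - uh (rho N) N.+1)) =
      (s N - du N) + rho N *: u (rho N) N.+2.
    by rewrite sE /du qE -/(rho N); apply/colP => i; rewrite !mxE; ring.
  have -> : A *m y - z (rho N) N.+2 = A *m (y - x (rho N) N.+2) +
      (rho N)^-1 *: (s N - dz N).
    rewrite sE /dz qE -/(rho N) mulmxBr; apply/colP => i; rewrite !mxE; field.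
    by rewrite gt_eqF.
  rewrite dotpDl dotpDr dotpZr [in X in _ + X]dotpZl mulKf ?gt_eqF //.
  move=> Hg Hf; rewrite /= !add2n; lra.
have [fx0 gx0 _] := edom_composite fp gp phix0.
(* Taking [y = x0] in [key] bounds the value at [X t] by a real number. *)
have phiX : edom (composite f g A) (X t).
  by rewrite /edom /=; apply: le_lt_trans (key _ phix0) (ltry _).
split=> // y phiy; have := key _ phiy.
have [_ _ ->] := edom_composite fp gp phiX.
have [_ _ ->] := edom_composite fp gp phiy.
rewrite -EFinB !lee_fin dotpNl; lra.
Qed.

(** * Assembling the solution on [[0, T]] *)

Lemma ae_neq {R : realType} (a : R) :
  {ae (@lebesgue_measure R), forall t : R, t != a}.
Proof.
exists [set a]; split; first exact: measurable_set1.
  exact: lebesgue_measure_set1.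
by move=> t /= /negP; rewrite negbK => /eqP.
Qed.

Theorem proposition7 (R : realType) (n m : nat)
    (f : 'cV[R]_n -> \bar R) (g : 'cV[R]_m -> \bar R) (A : 'M[R]_(m, n))
    (hS1 : assumption_S1 f g A)
    (hS2 : assumption_S2 (composite f g A))
    (alpha r : R) (halpha : 0 < alpha) (hr : 0 < r)
    (x0 : 'cV[R]_n) (hx0 : edom (composite f g A) x0)
    (x : R -> nat -> 'cV[R]_n) (z u zh uh : R -> nat -> 'cV[R]_m)
    (hiter : forall rho : R, 0 < rho ->
       raadmm f g A alpha r rho x0 (x rho) (z rho) (u rho) (zh rho) (uh rho))
    (T : R) (hT : 0 < T)
    (X : R -> 'cV[R]_n) (Z U Zh Uh : R -> 'cV[R]_m)
    (hX : continuum_limit T x X)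
    (hZ : continuum_limit T z Z)
    (hU : continuum_limit T u U)
    (hZh : continuum_limit T zh Zh)
    (hUh : continuum_limit T uh Uh) :
  solution T (composite f g A) A alpha r x0 X.
Proof.
have [_ _ [Vx [Wx [dX [Cx hVx] aeX]]]] := hX.
have [_ _ [Vz [Wz [dZ [Cz hVz] aeZ]]]] := hZ.
have [_ _ [Vu [Wu [dU [Cu hVu] aeU]]]] := hU.
have in0T t : 0 < t < T -> t \in `[0, T].
  by case/andP=> t0 tT; rewrite in_itv /= !ltW.
have hVx' : \forall rho \near +oo%R, derivative_bound T rho `|Cx| (x rho) Vx.
  by apply: filterS hVx => rho; exact: derivative_bound_norm.
have [K lipK] := continuum_limit_lipschitz hX (normr_ge0 _) hVx'.
have [fx0 _ _] := edom_composite (S1_f_proper hS1) (S1_g_proper hS1) hx0.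
have [X0 Vx0] := raadmm_initial_velocity hS1 fx0 hT hiter hX hVx.
have ZX t : 0 < t < T -> Z t = A *m X t.
  by move=> tT; have [] := raadmm_consensus halpha hr hiter hX hZ hU hZh hUh _ tT.
have U0 t : 0 < t < T -> U t = 0.
  exact: raadmm_dual_zero hS1 halpha hr hiter hX hZ hU hZh hUh t.
(* Written with the zero matrix so that [derivative_at_mulmx] also yields the first and second
   derivatives of [U]. *)
have U0X t : 0 < t < T -> U t = 0 *m X t by move=> /U0 ->; rewrite mul0mx.
have VzE t : 0 < t < T -> Vz t = A *m Vx t.
  move=> tT; have tT' := in0T _ tT.
  exact: derivative_at_mulmx ZX tT (dX _ tT') (dZ _ tT').
have VuE t : 0 < t < T -> Vu t = 0 *m Vx t.
  move=> tT; have tT' := in0T _ tT.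
  exact: derivative_at_mulmx U0X tT (dX _ tT') (dU _ tT').
exists Vx, Wx; split=> //.
  by split; apply: (@lipschitz_absolutely_continuous _ _ _ K) => s t s0 st tT;
    have [] := lipK _ _ s0 st tT.
have aeF : Filter (almost_everywhere (@lebesgue_measure R)).
  exact: ae_filter_ringOfSetsType.
(* The endpoints form a null set, discarded together with the times where a second derivative of
   [X], [Z] or [U] is missing. *)
apply: filterS2 (filterI (ae_neq 0) (ae_neq T)) (filterI aeX (filterI aeZ aeU)).
move=> t [tn0 tnT] [atX [atZ atU]] tT.
have tT' : 0 < t < T.
  move: tT; rewrite in_itv /= => /andP[t0 tT].
  by rewrite !lt_neqAle eq_sym tn0 tnT t0 tT.
have [dVx _] := atX tT; have [dVz [Cz' hWz]] := atZ tT.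
have [dVu [Cu' hWu]] := atU tT.
split=> //.
have WzE := derivative_at_mulmx VzE tT' dVx dVz.
have WuE := derivative_at_mulmx VuE tT' dVx dVu.
(* The vector [w] is [Wx t + (r / (t + 1)) *: Vx t]. Its image under [A] is the inertial limit for
   [z], because [Vz] and [Wz] are the images of [Vx] and [Wx]; the inertial limit for [u] is 0. *)
apply: (raadmm_inclusion hS1 hx0 halpha hiter hX hZ hU tT' (ZX _ tT') (U0 _ tT')).
  rewrite mulmxDr -scalemxAr -WzE -VzE //.
  by apply: (inertial_cvg _ hVz hWz hr tT') => rho /hiter/raadmm_zh.
have -> : 0 = Wu t + (r / (t + 1)) *: Vu t.
  by rewrite WuE VuE // !mul0mx scaler0 addr0.
by apply: (inertial_cvg _ hVu hWu hr tT') => rho /hiter/raadmm_uh.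
Qed.
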